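(* Let $(\mathcal{X},Q,\pi)$ be a Markov triple, let $\Lambda$ be an admissible mean, and let $\mathcal{Y}$ be a connected subset of $\mathcal{X}$. If $\mathcal{Y}$ has the retraction property, then every Hamilton--Jacobi subsolution on $\mathcal{Y}$ can be extended to a Hamilton--Jacobi subsolution on $\mathcal{X}$; that is, for every $S>0$ and every $\phi\in\mathsf{HJ}^S_{\mathcal{Y}}$ there exists $\bar\phi\in\mathsf{HJ}^S_{\mathcal{X}}$ with $\bar\phi_t(y)=\phi_t(y)$ for all $y\in\mathcal{Y}$ and all $t$.
   Context: Markov triple: $\mathcal{X}$ is a finite set; $Q:\mathcal{X}\times\mathcal{X}\to\mathbb{R}_+=[0,\infty)$ are transition rates with $Q(x,x)=0$; $Q$ is irreducible (any $x,y\in\mathcal{X}$ are connected by a path $x=x_0,\dots,x_n=y$ with $Q(x_{i-1},x_i)>0$); $\pi$ is the unique (strictly positive) stationary probability measure; and $Q$ is reversible: $\pi(x)Q(x,y)=\pi(y)Q(y,x)$ for all $x,y$. $\mathcal{P}(\mathcal{X})$ is the set of probability measures on $\mathcal{X}$. Admissible mean: a continuous function $\Lambda:\mathbb{R}_+\times\mathbb{R}_+\to\mathbb{R}_+$ that is $C^\infty$ on $(0,\infty)^2$, symmetric, positively $1$-homogeneous, non-decreasing in each variable, jointly concave, with $\Lambda(1,1)=1$. Connected subset: $\mathcal{Y}\subseteq\mathcal{X}$ is connected if any two distinct points of $\mathcal{Y}$ can be joined by a path $y_0,\dots,y_n$ in $\mathcal{Y}$ with $Q(y_{i-1},y_i)>0$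 for all $i$. The restriction of $(\mathcal{X},Q,\pi)$ to a connected subset $\mathcal{Y}$ is the Markov triple $(\mathcal{Y},Q|_{\mathcal{Y}\times\mathcal{Y}},\pi|_{\mathcal{Y}})$, with $\pi|_{\mathcal{Y}}$ the normalised restriction of $\pi$. Retraction property: a connected subset $\mathcal{Y}\subseteq\mathcal{X}$ has the retraction property if there is a map $T:\mathcal{X}\to\mathcal{Y}$ (a retraction) such that $T(y)=y$ for all $y\in\mathcal{Y}$, and for all $y,y'\in\mathcal{Y}$ with $y\ne y'$ and all $x\in T^{-1}(y)$, $\sum_{x'\in T^{-1}(y')}Q(x,x')\le Q(y,y')$. Notation: $\langle\phi,\psi\rangle=\sum_{x}\phi(x)\psi(x)$; $\nabla\phi(x,y)=\phi(y)-\phi(x)$; for $\Phi\in\mathbb{R}^{\mathcal{X}\times\mathcal{X}}$, $\|\Phi\|_\mu^2=\frac12\sum_{x,y}\Phi(x,y)^2\,\Lambda(\mu(x)Q(x,y),\mu(y)Q(y,x))$. Hamilton--Jacobi subsolutions: for $S>0$, $\mathsf{HJ}^S_{\mathcal{X}}$ is the set of $\phi\in H^1((0,S);\mathbb{R}^{\mathcal{X}})$ such that for a.e. $t\in(0,S)$, $\langle\dot\phi_t,\mu\rangle+\frac12\|\nabla\phi_t\|_\mu^2\le0$ for all $\mu\in\mathcal{P}(\mathcal{X})$. $\mathsf{HJ}^S_{\mathcal{Y}}$ is defined in the same way for the restricted Markov triple $(\mathcal{Y},Q|_{\mathcal{Y}\times\mathcal{Y}},\pi|_{\mathcal{Y}})$,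 with the same mean $\Lambda$. *)

(* Defs.v *)
From HB Require Import structures.
From mathcomp Require Import all_boot all_order all_algebra.
From mathcomp Require Import all_classical all_reals all_analysis.
Set Implicit Arguments.
Unset Strict Implicit.
Unset Printing Implicit Defensive.
Import Order.TTheory GRing.Theory Num.Theory.
Import numFieldNormedType.Exports.
Local Open Scope classical_set_scope.
Local Open Scope ring_scope.

Definition prob_vec (R : realType) (X : finType) (mu : X -> R) : Prop :=
  (forall x, 0 <= mu x) /\ \sum_x mu x = 1.

(* Uniqueness of [pi] is a consequence of irreducibility. *)
Record markov_triple (R : realType) (X : finType)
    (Q : X -> X -> R) (pi : X -> R) : Prop := MarkovTriple {
  rate_ge0 : forall x y, 0 <= Q x y ;
  rate_diag : forall x, Q x x = 0 ;
  rate_irreducible : forall x y, connect [rel a b | 0 < Q a b] x y ;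
  stat_prob : prob_vec pi ;
  stat_gt0 : forall x, 0 < pi x ;
  stat_stationary : forall y, \sum_x pi x * Q x y = pi y * \sum_x Q y x ;
  stat_reversible : forall x y, pi x * Q x y = pi y * Q y x
}.

(* C^n on an open set [U], through iterated directional derivatives: all of
   those of order at most n exist and are continuous on [U]. Only the values of
   [f] on [U] matter, because [U] is open. *)
Fixpoint Cn_on (R : realType) (V : normedModType R) (n : nat)
    (U : set V) (f : V -> R^o) : Prop :=
  (forall p, U p -> {for p, continuous f}) /\
  (if n is m.+1 then
     forall v : V, (forall p, U p -> derivable f p v) /\ Cn_on m U ('D_v f)
   else True).

Definition smooth_on (R : realType) (V : normedModType R)
    (U : set V) (f : V -> R^o) : Prop := forall n, Cn_on n U f.

(* A function R_+ x R_+ -> R_+ is encoded by a function R -> R -> R that is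
   constrained only on nonnegative arguments. *)
Record admissible_mean (R : realType) (L : R -> R -> R) : Prop :=
  AdmissibleMean {
  mean_ge0 : forall a b, 0 <= a -> 0 <= b -> 0 <= L a b ;
  mean_continuous : {within [set p : R^o * R^o | 0 <= p.1 /\ 0 <= p.2],
                      continuous (fun p : R^o * R^o => L p.1 p.2 : R^o)} ;
  mean_smooth : smooth_on [set p : R^o * R^o | 0 < p.1 /\ 0 < p.2]
                          (fun p : R^o * R^o => L p.1 p.2) ;
  mean_sym : forall a b, 0 <= a -> 0 <= b -> L a b = L b a ;
  mean_homo : forall c a b, 0 < c -> 0 <= a -> 0 <= b ->
    L (c * a) (c * b) = c * L a b ;
  mean_mono_l : forall a a' b, 0 <= a -> a <= a' -> 0 <= b -> L a b <= L a' b ;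
  mean_mono_r : forall a b b', 0 <= a -> 0 <= b -> b <= b' -> L a b <= L a b' ;
  mean_concave : forall t a b a' b', 0 <= t -> t <= 1 ->
    0 <= a -> 0 <= b -> 0 <= a' -> 0 <= b' ->
    t * L a b + (1 - t) * L a' b' <=
    L (t * a + (1 - t) * a') (t * b + (1 - t) * b') ;
  mean_11 : L 1 1 = 1
}.

Definition rate_connected (R : realType) (X : finType) (Q : X -> X -> R)
    (Y : {set X}) : Prop :=
  forall y y', y \in Y -> y' \in Y ->
    connect [rel a b | [&& a \in Y, b \in Y & 0 < Q a b]] y y'.

Definition restr_rate (R : realType) (X : finType) (Q : X -> X -> R)
    (Y : {set X}) (y y' : {x : X | x \in Y}) : R := Q (val y) (val y').

Definition restr_stat (R : realType) (X : finType) (pi : X -> R)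
    (Y : {set X}) (y : {x : X | x \in Y}) : R :=
  pi (val y) / \sum_(x in Y) pi x.

Arguments restr_rate {R X} Q Y y y'.
Arguments restr_stat {R X} pi Y y.

Definition retraction_property (R : realType) (X : finType)
    (Q : X -> X -> R) (Y : {set X}) : Prop :=
  exists T : X -> {x : X | x \in Y},
    (forall y, T (val y) = y) /\
    (forall (y y' : {x : X | x \in Y}) (x : X), y != y' -> T x = y ->
       \sum_(x' | T x' == y') Q x x' <= Q (val y) (val y')).

Definition pairing (R : realType) (X : finType) (phi psi : X -> R) : R :=
  \sum_x phi x * psi x.

Definition discr_grad (R : realType) (X : finType) (phi : X -> R) :
  X -> X -> R := fun x y => phi y - phi x.

Definition sqnorm (R : realType) (X : finType) (Q : X -> X -> R)
    (L : R -> R -> R) (mu : X -> R) (Phi : X -> X -> R) : R :=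
  2^-1 * \sum_x \sum_y Phi x y ^+ 2 * L (mu x * Q x y) (mu y * Q y x).

Definition sq_integrable (R : realType) (S : R) (f : R -> R) : Prop :=
  measurable_fun (`]0, S[ : set R) f /\
  (@lebesgue_measure R).-integrable `]0, S[ (fun t => (f t ^+ 2)%:E).

Definition test_function (R : realType) (S : R) (eta : R^o -> R^o) : Prop :=
  [/\ smooth_on [set: R^o] eta,
      compact (closure [set t | eta t != 0]) &
      closure [set t | eta t != 0] `<=` `]0, S[].

(* [f] belongs to H^1(0, S) with weak derivative [g]. Since point values of
   elements of H^1 are used, the element is given by its continuous
   representative on (0, S); values outside (0, S) are irrelevant. *)
Definition H1_with_deriv (R : realType) (S : R) (f g : R -> R) : Prop :=
  [/\ forall t : R^o, 0 < t < S -> {for t, continuous (f : R^o -> R^o)},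
      sq_integrable S f,
      sq_integrable S g &
      forall eta : R^o -> R^o, test_function S eta ->
        \int[@lebesgue_measure R]_(t in `]0, S[) (f t * derive1 eta t) =
        - \int[@lebesgue_measure R]_(t in `]0, S[) (g t * eta t)].

(* The weak derivative [dphi] is unique almost everywhere. *)
Definition HJ (R : realType) (X : finType) (Q : X -> X -> R)
    (L : R -> R -> R) (S : R) (phi : R -> X -> R) : Prop :=
  exists dphi : R -> X -> R,
    (forall x, H1_with_deriv S (phi^~ x) (dphi^~ x)) /\
    {ae @lebesgue_measure R, forall t, 0 < t < S ->
      forall mu, prob_vec mu ->
        pairing (dphi t) mu +
        2^-1 * sqnorm Q L mu (discr_grad (phi t)) <= 0}.

Lemma restr_markov_triple (R : realType) (X : finType) (Q : X -> X -> R)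
    (pi : X -> R) (Y : {set X}) :
  markov_triple Q pi -> rate_connected Q Y -> Y != finset.set0 ->
  markov_triple (restr_rate Q Y) (restr_stat pi Y).
Proof.
move=> [Q0 Qd _ _ pi0 _ Qr] cY /set0Pn[y0 Yy0].
have Z0 : 0 < \sum_(x in Y) pi x.
  by rewrite (bigD1 y0)//= ltr_pwDl// sumr_ge0// => i _; exact: ltW.
have rev (x y : {x | x \in Y}) : restr_stat pi Y x * restr_rate Q Y x y =
    restr_stat pi Y y * restr_rate Q Y y x.
  by rewrite /restr_stat /restr_rate mulrAC Qr mulrAC.
split.
- by move=> x y; exact: Q0.
- by move=> x; exact: Qd.
- move=> [x Yx] [y Yy].
  have /connectP[p] := cY x y Yx Yy.
  elim: p x Yx => [|z p IH] x Yx /=.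
    by move=> _ exy; subst y; rewrite (bool_irrelevance Yx Yy).
  case/andP => /and3P[_ Yz xz] pz lz.
  apply: (connect_trans (y := exist _ z Yz)); last exact: IH.
  exact: connect1.
- split=> [x|]; first by rewrite divr_ge0// ltW.
  by rewrite -mulr_suml -(big_sub (mem Y))/= divff// gt_eqF.
- by move=> x; rewrite divr_gt0.
- by move=> y; rewrite mulr_sumr; apply: eq_bigr => x _; exact: rev.
- exact: rev.
Qed.

(* Main.v *)
Require Import Defs.
From HB Require Import structures.
From mathcomp Require Import all_boot all_order all_algebra.
From mathcomp Require Import all_classical all_reals all_analysis.
Import Order.TTheory GRing.Theory Num.Theory.
Import numFieldNormedType.Exports.
Local Open Scope ring_scope.

Set Implicit Arguments.
Unset Strict Implicit.

(** The extension is [phi] composed with the retraction [T]. The Sobolev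
    condition is stated coordinate by coordinate, so it is inherited at once.
    For the inequality at [mu], compare with the inequality for [phi] at the
    pushforward [nu] of [mu] under [T]: the linear terms agree by change of
    variables, and the quadratic term can only decrease when passing from [nu]
    back to [mu] ([sqnorm_push]). Indeed, group the edges of the big space by
    the pair of fibres that they join. Edges inside a fibre do not contribute,
    because the gradient of [phi \o T] vanishes there. Between the fibres of
    [z != z'] the gradient is constant, and the total weight is at most the
    mean of the two total flows, since a concave 1-homogeneous function is
    superadditive ([mean_superadd]). The retraction property bounds these flows
    by [nu z * Q z z'] and [nu z' * Q z' z], and the mean is monotone. *)

Lemma mean_00 (R : realType) (L : R -> R -> R) :
  admissible_mean L -> L 0 0 = 0.
Proof.
move=> hL; have := mean_homo hL (ltr0Sn R 1) (lexx 0) (lexx 0).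
rewrite mulr0 mulr_natl mulr2n => /esym/eqP.
by rewrite -subr_eq0 addrK => /eqP.
Qed.

(** Concavity at the midpoint, with the factor 1/2 removed by homogeneity. *)
Lemma mean_superadd2 (R : realType) (L : R -> R -> R) (a b a' b' : R) :
  admissible_mean L -> 0 <= a -> 0 <= b -> 0 <= a' -> 0 <= b' ->
  L a b + L a' b' <= L (a + a') (b + b').
Proof.
move=> hL a0 b0 a'0 b'0.
have h0 : 0 < 2^-1 :> R by rewrite invr_gt0.
have h1 : 2^-1 <= 1 :> R by rewrite invf_le1// ler1n.
have hB : 1 - 2^-1 = 2^-1 :> R by rewrite [X in X - _]splitr mul1r addrK.
have := mean_concave hL (ltW h0) h1 a0 b0 a'0 b'0.
by rewrite hB -!mulrDr (mean_homo hL) ?addr_ge0// ler_pM2l.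
Qed.

Lemma mean_superadd (R : realType) (L : R -> R -> R) (I : finType)
    (P : pred I) (a b : I -> R) :
  admissible_mean L -> (forall i, 0 <= a i) -> (forall i, 0 <= b i) ->
  \sum_(i | P i) L (a i) (b i) <= L (\sum_(i | P i) a i) (\sum_(i | P i) b i).
Proof.
move=> hL a0 b0.
suff [] : [/\ 0 <= \sum_(i | P i) a i, 0 <= \sum_(i | P i) b i &
    \sum_(i | P i) L (a i) (b i) <=
    L (\sum_(i | P i) a i) (\sum_(i | P i) b i)] by [].
elim/big_rec3 : _ => [|i l s r _ [r0 s0 le_lsr]]; first by rewrite mean_00.
split; rewrite ?addr_ge0//.
by apply: le_trans (mean_superadd2 hL _ _ _ _); rewrite ?lerD2l.
Qed.

Definition push (R : realType) (X Z : finType) (T : X -> Z) (mu : X -> R)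
    (z : Z) : R := \sum_(x | T x == z) mu x.

Lemma pairing_push (R : realType) (X Z : finType) (T : X -> Z) (mu : X -> R)
    (psi : Z -> R) :
  pairing (fun x => psi (T x)) mu = pairing psi (push T mu).
Proof.
rewrite /pairing (partition_big T predT)//=; apply: eq_bigr => z _.
by rewrite mulr_sumr; apply: eq_bigr => x /eqP <-.
Qed.

Lemma prob_vec_push (R : realType) (X Z : finType) (T : X -> Z)
    (mu : X -> R) : prob_vec mu -> prob_vec (push T mu).
Proof.
move=> [mu0 mu1]; split=> [z|]; first by apply: sumr_ge0.
by rewrite -mu1 [RHS](partition_big T predT).
Qed.

(** The weight of all edges between the fibres of two distinct points: the
    hypothesis on [T] bounds the flow in each of the two directions. *)
Lemma mean_fibres (R : realType) (X Z : finType) (Q : X -> X -> R)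
    (QZ : Z -> Z -> R) (L : R -> R -> R) (T : X -> Z) (mu : X -> R)
    (z z' : Z) :
  admissible_mean L -> (forall x y, 0 <= Q x y) -> (forall x, 0 <= mu x) ->
  (forall x w, T x != w -> \sum_(x' | T x' == w) Q x x' <= QZ (T x) w) ->
  z != z' ->
  \sum_(x | T x == z) \sum_(x' | T x' == z')
    L (mu x * Q x x') (mu x' * Q x' x) <=
  L (push T mu z * QZ z z') (push T mu z' * QZ z' z).
Proof.
move=> hL Q0 mu0 hT zz'.
have flow0 x x' : 0 <= mu x * Q x x' by rewrite mulr_ge0.
have flow u w : u != w ->
    \sum_(x | T x == u) \sum_(x' | T x' == w) mu x * Q x x' <=
    push T mu u * QZ u w.
  move=> uw; rewrite /push mulr_suml; apply: ler_sum => x /eqP Tx.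
  by rewrite -mulr_sumr ler_wpM2l// -Tx hT// Tx.
have sum0 (P P' : pred X) (F : X -> X -> R) : (forall x x', 0 <= F x x') ->
    0 <= \sum_(x | P x) \sum_(x' | P' x') F x x'.
  by move=> F0; apply: sumr_ge0 => x _; exact: sumr_ge0.
pose A := \sum_(x | T x == z) \sum_(x' | T x' == z') mu x * Q x x'.
pose B := \sum_(x | T x == z) \sum_(x' | T x' == z') mu x' * Q x' x.
have A0 : 0 <= A by exact: sum0.
have B0 : 0 <= B by exact: sum0.
have leA : A <= push T mu z * QZ z z' by exact: flow.
have leB : B <= push T mu z' * QZ z' z.
  by rewrite /B exchange_big; apply: flow; rewrite eq_sym.
apply: (@le_trans _ _ (L A B)).
  apply: le_trans (mean_superadd _ hL _ _) => [|x|x]; last 2 first.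
  - exact: sumr_ge0.
  - exact: sumr_ge0.
  by apply: ler_sum => x _; exact: mean_superadd.
apply: (le_trans (mean_mono_l hL A0 leA B0)).
by apply: (mean_mono_r hL _ B0 leB); exact: le_trans leA.
Qed.

Lemma sqnorm_push (R : realType) (X Z : finType) (Q : X -> X -> R)
    (QZ : Z -> Z -> R) (L : R -> R -> R) (T : X -> Z) (mu : X -> R)
    (psi : Z -> R) :
  admissible_mean L -> (forall x y, 0 <= Q x y) -> (forall x, 0 <= mu x) ->
  (forall x w, T x != w -> \sum_(x' | T x' == w) Q x x' <= QZ (T x) w) ->
  sqnorm Q L mu (discr_grad (fun x => psi (T x))) <=
  sqnorm QZ L (push T mu) (discr_grad psi).
Proof.
move=> hL Q0 mu0 hT; rewrite /sqnorm ler_wpM2l ?invr_ge0//.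
rewrite (partition_big T predT)//=; apply: ler_sum => z _.
under eq_bigr do rewrite (partition_big T predT)//=.
rewrite exchange_big/=; apply: ler_sum => z' _.
(* The gradient is constant on the edges between two fibres. *)
rewrite (_ : \sum_(x | _) _ = discr_grad psi z z' ^+ 2 *
    \sum_(x | T x == z) \sum_(x' | T x' == z')
      L (mu x * Q x x') (mu x' * Q x' x)); last first.
  rewrite mulr_sumr; apply: eq_bigr => x /eqP <-.
  by rewrite mulr_sumr; apply: eq_bigr => x' /eqP <-.
have [<-|zz'] := eqVneq z z'.
  by rewrite /discr_grad subrr expr0n !mul0r.
by rewrite ler_wpM2l ?sqr_ge0//; exact: (mean_fibres hL Q0 mu0 hT zz').
Qed.

Unset Implicit Arguments.
Set Strict Implicit.

Theorem theorem4p10 (R : realType) (X : finType)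
    (Q : X -> X -> R) (pi : X -> R) (L : R -> R -> R) (Y : {set X})
    (hX : markov_triple Q pi) (hL : admissible_mean L)
    (hY : rate_connected Q Y) (hT : retraction_property Q Y) :
  forall (S : R), 0 < S ->
  forall phi : R -> {x : X | x \in Y} -> R,
    HJ (restr_rate Q Y) L S phi ->
    exists phibar : R -> X -> R,
      HJ Q L S phibar /\
      forall t : R, 0 < t < S ->
        forall y : {x : X | x \in Y}, phibar t (val y) = phi t y.
Proof.
move=> S _ phi [dphi [Hphi HJphi]].
have [T [TK hTQ]] := hT.
exists (fun t x => phi t (T x)); split; last by move=> t _ y; rewrite TK.
exists (fun t x => dphi t (T x)); split; first by move=> x; exact: Hphi.
move: HJphi; apply: negligibleS; apply: subsetC => t + tS mu pmu.
move=> /(_ tS _ (prob_vec_push T pmu)); apply: le_trans.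
rewrite pairing_push lerD2l ler_wpM2l ?invr_ge0//.
apply: sqnorm_push => //; first exact: rate_ge0 hX.
  by case: pmu.
by move=> x w Txw; exact: hTQ.
Qed.
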